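(* Every maximally almost periodic locally compact group is residually SIN; that is, $[\mathrm{MAP}]\subseteq[\mathrm{RSIN}]$.
   Context: A locally compact group $G$ is maximally almost periodic, $G\in[\mathrm{MAP}]$, if its continuous finite-dimensional unitary representations separate the points of $G$. It is a small invariant neighbourhood group, $G\in[\mathrm{SIN}]$, if the identity has a neighbourhood base consisting of conjugation-invariant neighbourhoods. It is residually SIN, $G\in[\mathrm{RSIN}]$, if the intersection of all closed normal subgroups $N$ of $G$ with $G/N\in[\mathrm{SIN}]$ is $\{e\}$. *)

(* Defs.v *)
From HB Require Import structures.
From mathcomp Require Import all_boot all_order all_algebra spectral.
From mathcomp Require Import complex.
From mathcomp Require Import all_classical all_reals all_analysis.

Set Implicit Arguments.
Unset Strict Implicit.
Unset Printing Implicit Defensive.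

Import Order.TTheory GRing.Theory Num.Theory.
Import numFieldNormedType.Exports.

(* The library gives the norm topology to abstract numeric fields only; here
   it is given to the concrete field R[i], so that 'M[R[i]]_n gets the
   entrywise topology. *)
#[non_forgetful_inheritance]
HB.instance Definition _ (R : rcfType) :=
  NormedModule.copy R[i] (R[i] : numFieldType)^o.

Local Open Scope classical_set_scope.
Local Open Scope group_scope.

HB.structure Definition PreTopologicalGroup := {G of Topological G & Group G}.

HB.mixin Record PreTopologicalGroup_isTopologicalGroup G
    & PreTopologicalGroup G := {
  mulg_continuous : continuous (fun x : G * G => x.1 * x.2) ;
  invg_continuous : continuous (fun x : G => x^-1)
}.

#[short(type="topologicalGroupType")]
HB.structure Definition TopologicalGroup :=
  {G of PreTopologicalGroup G & PreTopologicalGroup_isTopologicalGroup G}.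

Record normalSubgroup (G : groupType) := NormalSubgroup {
  nsg_set :> set G ;
  nsg1 : nsg_set 1 ;
  nsgM : forall x y, nsg_set x -> nsg_set y -> nsg_set (x * y) ;
  nsgV : forall x, nsg_set x -> nsg_set x^-1 ;
  nsgJ : forall g x, nsg_set x -> nsg_set (g * x * g^-1)
}.

Section QuotientGroup.
Variables (G : topologicalGroupType) (N : normalSubgroup G).

Definition coset_rel : rel G := fun x y => `[< nsg_set N (x^-1 * y) >].

Lemma coset_relP x y : reflect (nsg_set N (x^-1 * y)) (coset_rel x y).
Proof. exact: asboolP. Qed.

Fact coset_rel_refl : reflexive coset_rel.
Proof. by move=> x; apply/coset_relP; rewrite mulVg; exact: nsg1. Qed.

Fact coset_rel_sym : symmetric coset_rel.
Proof.
have H x y : coset_rel x y -> coset_rel y x.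
  by move=> /coset_relP /nsgV; rewrite invgM invgK => ?; apply/coset_relP.
by move=> x y; apply/idP/idP; exact: H.
Qed.

Fact coset_rel_trans : transitive coset_rel.
Proof.
move=> y x z /coset_relP xy /coset_relP yz; apply/coset_relP.
by have := nsgM xy yz; rewrite mulgA mulgK.
Qed.

Canonical coset_equiv := EquivRel coset_rel
  coset_rel_refl coset_rel_sym coset_rel_trans.

Definition quotient_group : Type := quotient_topology {eq_quot coset_equiv}%qT.
HB.instance Definition _ := Topological.on quotient_group.
HB.instance Definition _ := Quotient.on quotient_group.

Local Notation Q := quotient_group.
Local Notation pi := (\pi_Q%qT : G -> Q).

Lemma pi_quotient_groupP x y : pi x = pi y <-> nsg_set N (x^-1 * y).
Proof.
split; last by move=> /coset_relP xy; exact/(@eqmodP _ coset_equiv).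
by move=> /(@eqmodP _ coset_equiv) /coset_relP.
Qed.

Definition quotient_one : Q := pi 1.
Definition quotient_mul (a b : Q) : Q := pi (repr a * repr b).
Definition quotient_inv (a : Q) : Q := pi (repr a)^-1.

Lemma repr_pi x : nsg_set N ((repr (pi x))^-1 * x).
Proof. by apply/pi_quotient_groupP; rewrite reprK. Qed.

Lemma pi_mul x y : pi (x * y) = quotient_mul (pi x) (pi y).
Proof.
apply/esym/pi_quotient_groupP; have := repr_pi x; have := repr_pi y.
set a := repr _; set b := repr _ => ay bx.
have := nsgM (nsgJ a^-1 bx) ay.
by rewrite invgK !invgM !mulgA mulgK.
Qed.

Lemma pi_inv x : pi x^-1 = quotient_inv (pi x).
Proof.
apply/pi_quotient_groupP; have := nsgJ x (repr_pi x).
by rewrite invgK !mulgA mulgK.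
Qed.

Fact quotient_mulA : associative quotient_mul.
Proof.
move=> a b c; rewrite -[a]reprK -[b]reprK -[c]reprK.
move: (repr a) (repr b) (repr c) => x y z.
by rewrite -(pi_mul y z) -(pi_mul x y) -(pi_mul x) -(pi_mul _ z) mulgA.
Qed.

Fact quotient_mul1g : left_id quotient_one quotient_mul.
Proof. by move=> a; rewrite -[a]reprK -pi_mul mul1g. Qed.

Fact quotient_mulg1 : right_id quotient_one quotient_mul.
Proof. by move=> a; rewrite -[a]reprK -pi_mul mulg1. Qed.

Fact quotient_mulVg : left_inverse quotient_one quotient_inv quotient_mul.
Proof. by move=> a; rewrite -[a]reprK -pi_inv -pi_mul mulVg. Qed.

Fact quotient_mulgV : right_inverse quotient_one quotient_inv quotient_mul.
Proof. by move=> a; rewrite -[a]reprK -pi_inv -pi_mul mulgV. Qed.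

HB.instance Definition _ := isGroup.Build Q
  quotient_mulA quotient_mul1g quotient_mulg1 quotient_mulVg quotient_mulgV.

Lemma pi_open (A : set G) : open A -> open (pi @` A).
Proof.
move=> oA; rewrite /open/= /quotient_open.
rewrite (_ : _ @^-1` _ =
  \bigcup_(n in nsg_set N) ((fun x => x * n) @^-1` A)); last first.
  apply/seteqP; split => x /=.
    move=> [a Aa] /esym/pi_quotient_groupP xa.
    by exists (x^-1 * a) => //=; rewrite mulgA mulgV mul1g.
  move=> [n Nn /= Axn]; exists (x * n) => //.
  by apply/esym/pi_quotient_groupP; rewrite mulgA mulVg mul1g.
apply: bigcup_open => n _; apply: open_comp => // x _.
apply: (@continuous_comp _ _ _ (fun x : G => (x, n))
  (fun x : G * G => x.1 * x.2)); last exact: mulg_continuous.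
by apply: cvg_pair => /=; [exact: cvg_id|exact: cvg_cst].
Qed.

Lemma pi_nbhs (x : G) (A : set G) : nbhs x A -> nbhs (pi x) (pi @` A).
Proof.
rewrite nbhsE => -[B [oB Bx] BA]; rewrite nbhsE; exists (pi @` B).
  by split; [exact: pi_open|exists x].
exact: image_subset.
Qed.

Fact quotient_mul_continuous : continuous (fun x : Q * Q => x.1 * x.2).
Proof.
move=> [a b] /= U; rewrite -[a]reprK -[b]reprK.
set x := repr a; set y := repr b => piU.
have : nbhs (x * y) (pi @^-1` U).
  by apply: pi_continuous; rewrite pi_mul.
move=> /(@mulg_continuous G (x, y)) [[A B] /= [Ax By] ABU].
exists (pi @` A, pi @` B); first by split; exact: pi_nbhs.
move=> [_ _] /= [[u Au <-] [v Bv <-]].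
by have := ABU (u, v) (conj Au Bv); rewrite /= pi_mul.
Qed.

Fact quotient_inv_continuous : continuous (fun x : Q => x^-1).
Proof.
apply/(@quotient_continuous _ {eq_quot coset_equiv}%qT) => x.
rewrite (_ : _ \o _ = pi \o (fun x => x^-1)); last first.
  by apply/funext => y /=; rewrite pi_inv.
apply: continuous_comp; first exact: invg_continuous.
exact: pi_continuous.
Qed.

HB.instance Definition _ := PreTopologicalGroup_isTopologicalGroup.Build Q
  quotient_mul_continuous quotient_inv_continuous.

End QuotientGroup.

Definition unitary_representation (R : realType) (G : topologicalGroupType)
    (n : nat) (rho : G -> 'M[R[i]]_n) : Prop :=
  [/\ forall g, rho g \is unitarymx,
      forall g h, rho (g * h) = (rho g *m rho h)%R
    & continuous rho].

Definition MAP (R : realType) (G : topologicalGroupType) : Prop :=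
  forall x y : G, x <> y ->
  exists (n : nat) (rho : G -> 'M[R[i]]_n),
    unitary_representation rho /\ rho x <> rho y.

Definition SIN (G : topologicalGroupType) : Prop :=
  forall U : set G, nbhs 1 U ->
  exists V : set G, [/\ nbhs 1 V, V `<=` U
    & forall g x, V x -> V (g * x * g^-1)].

Definition RSIN (G : topologicalGroupType) : Prop :=
  \bigcap_(N in [set N : normalSubgroup G |
                  closed N /\ SIN (quotient_group N)]) N = [set 1].

Definition locally_compact_group (G : topologicalGroupType) : Prop :=
  hausdorff_space G /\ locally_compact [set: G].

(* Main.v *)
Require Import Defs.
From HB Require Import structures.
From mathcomp Require Import all_boot all_order all_algebra spectral sesquilinear.
From mathcomp Require Import complex.
From mathcomp Require Import all_classical all_reals all_analysis.
From mathcomp Require Import ring lra.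

Set Implicit Arguments.
Unset Strict Implicit.
Unset Printing Implicit Defensive.

Import Order.TTheory GRing.Theory Num.Theory.
Import numFieldNormedType.Exports.

(** A finite-dimensional unitary representation [rho] that does not kill [x] has
    a closed kernel [N] not containing [x], so it suffices that [G / N] be SIN.
    Thus one is reduced to a group [L] that has a compact neighbourhood [C] of
    the identity and a continuous injective unitary representation, again called
    [rho].

    The length [len x], the Frobenius norm of [rho x - 1], is subadditive and
    conjugation invariant, so its balls are invariant neighbourhoods.  They can
    be too large, because the topology of [L] may be finer than that of its
    image: a ball may consist of many sheets.  The sheet through the identity is
    recovered as the set of points that can be reached from the identity, inside
    the ball, by chains with arbitrarily small steps ([linked_component]).  This
    set is conjugation invariant by construction, and a chain with small steps
    cannot leave [C] ([linked_confined]), where [len] determines the topology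
    ([small_len_nbhs1]); so it is as small as desired.

    What remains is that it is a neighbourhood of the identity.  This is a
    chain version of the proof of Cartan's closed subgroup theorem, with powers
    instead of exponentials.  Otherwise, there are elements arbitrarily close to
    the identity that cannot be shortened by multiplication by an element of the
    linked component: divide any missing element by the nearest element of the
    component ([far_from_near_one]).  By compactness of the unit sphere of
    matrices, such elements [y] and [z] exist with [z] arbitrarily shorter than
    [y] and [rho y - 1], [rho z - 1] nearly parallel ([near_direction]).  Then a
    power of [z] is closer to [y] than the identity is ([rep_powers_approach]).
    The powers of [z] form a chain with steps [z], so as [z] tends to the
    identity a limit of such powers lies in the linked component
    ([linked_component_approx]), and it shortens [y]: a contradiction
    ([SIN_of_faithful_rep]). *)

Local Open Scope classical_set_scope.
Local Open Scope ring_scope.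

(** * The Frobenius norm *)

Section Frobenius.
Variables (R : realType).
Local Notation normc := (@ComplexField.Normc.normc R).
Local Notation "A ^t*" := (map_mx Num.conj A^T).

Definition frob m n (A : 'M[R[i]]_(m, n)) : R :=
  Num.sqrt (\sum_i \sum_j normc (A i j) ^+ 2).

Lemma sqr_normcE (z : R[i]) : (normc z ^+ 2)%:C%C = z * Num.conj z.
Proof. by rewrite -normCK rmorphXn. Qed.

Lemma frob_sqr m n (A : 'M[R[i]]_(m, n)) :
  frob A ^+ 2 = \sum_i \sum_j normc (A i j) ^+ 2.
Proof.
rewrite sqr_sqrtr//; apply: sumr_ge0 => i _; apply: sumr_ge0 => j _.
exact: sqr_ge0.
Qed.

Lemma frob_ge0 m n (A : 'M[R[i]]_(m, n)) : 0 <= frob A.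
Proof. exact: sqrtr_ge0. Qed.

(** Flattening a matrix to a row turns the Frobenius norm into a Hermitian
    norm, whence the triangle inequality below. *)
Lemma frob_dotmx m n (A : 'M[R[i]]_(m, n)) :
  (frob A ^+ 2)%:C%C = dotmx (mxvec A) (mxvec A).
Proof.
rewrite frob_sqr dotmxE !mxE [RHS](reindex _ (curry_mxvec_bij _ _)) /=.
rewrite pair_bigA rmorph_sum; apply: eq_bigr => -[i j] _ /=.
by rewrite !mxE mxvecE sqr_normcE.
Qed.

Lemma frob_sqrtC m n (A : 'M[R[i]]_(m, n)) :
  (frob A)%:C%C = sqrtC (dotmx (mxvec A) (mxvec A)).
Proof. by rewrite -frob_dotmx rmorphXn sqrCK// ler0c frob_ge0. Qed.

Lemma ler_frobD m n (A B : 'M[R[i]]_(m, n)) : frob (A + B) <= frob A + frob B.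
Proof.
rewrite -lecR rmorphD /= !frob_sqrtC linearD.
by have [+ _] := triangle_lerif (@dotmx _ _) (mxvec A) (mxvec B).
Qed.

Lemma frobZ m n (t : R) (A : 'M[R[i]]_(m, n)) :
  frob (t%:C%C *: A) = `|t| * frob A.
Proof.
apply/eqP; rewrite -(@eqrXn2 _ 2) ?mulr_ge0 ?frob_ge0//.
rewrite exprMn !frob_sqr mulr_sumr; apply/eqP/eq_bigr => i _.
rewrite mulr_sumr; apply: eq_bigr => j _.
rewrite mxE ComplexField.Normc.normcM exprMn; congr (_ * _).
by rewrite /= expr0n addr0 sqrtr_sqr.
Qed.

Lemma frob0 m n : frob (0 : 'M[R[i]]_(m, n)) = 0.
Proof. rewrite -(scale0r 0) -[0 in LHS](rmorph0 (real_complex R)) frobZ.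
by rewrite normr0 mul0r. Qed.

Lemma frobN m n (A : 'M[R[i]]_(m, n)) : frob (- A) = frob A.
Proof.
by rewrite -scaleN1r -(rmorphN1 (real_complex R)) frobZ normrN1 mul1r.
Qed.

Lemma frob_distC m n (A B : 'M[R[i]]_(m, n)) : frob (A - B) = frob (B - A).
Proof. by rewrite -frobN opprB. Qed.

Lemma frob_eq0 m n (A : 'M[R[i]]_(m, n)) : frob A = 0 -> A = 0.
Proof.
move=> A0; have /eqP := frob_dotmx A; rewrite A0 expr0n/= eq_sym.
by rewrite (dnorm_eq0 (@dotmx _ _)) mxvec_eq0 => /eqP.
Qed.

(** In this form, multiplication by a unitary matrix on either side is seen to
    preserve the norm; this makes the length defined by a unitary
    representation conjugation invariant. *)
Lemma frob_trace m n (A : 'M[R[i]]_(m, n)) :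
  (frob A ^+ 2)%:C%C = \tr (A *m A^t*).
Proof.
rewrite frob_sqr rmorph_sum; apply: eq_bigr => i _.
by rewrite mxE rmorph_sum; apply: eq_bigr => j _; rewrite !mxE -sqr_normcE.
Qed.

Lemma frob_trmxC m n (A : 'M[R[i]]_(m, n)) : frob (A^t*) = frob A.
Proof.
congr Num.sqrt; rewrite exchange_big.
apply: eq_bigr => i _; apply: eq_bigr => j _.
rewrite !mxE; apply: complexI; rewrite !sqr_normcE.
by rewrite conjCK mulrC.
Qed.

Lemma trmxCM m n p (A : 'M[R[i]]_(m, n)) (B : 'M[R[i]]_(n, p)) :
  (A *m B)^t* = B^t* *m A^t*.
Proof. by rewrite trmx_mul map_mxM. Qed.

Lemma frob_mulmxU m n (A : 'M[R[i]]_(m, n)) (U : 'M[R[i]]_n) :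
  U \is unitarymx -> frob (A *m U) = frob A.
Proof.
move=> /unitarymxP Uu; apply/eqP; rewrite -(@eqrXn2 _ 2) ?frob_ge0//.
apply/eqP/complexI; rewrite !frob_trace trmxCM.
by rewrite -mulmxA (mulmxA U) Uu mul1mx.
Qed.

Lemma frob_Umulmx m n (A : 'M[R[i]]_(m, n)) (U : 'M[R[i]]_m) :
  U \is unitarymx -> frob (U *m A) = frob A.
Proof.
move=> Uu; rewrite -frob_trmxC trmxCM frob_mulmxU ?frob_trmxC//.
by rewrite trmxC_unitary.
Qed.

(** Cauchy-Schwarz for each row of [A] against each column of [B]. *)
Lemma frobM m n p (A : 'M[R[i]]_(m, n)) (B : 'M[R[i]]_(n, p)) :
  frob (A *m B) <= frob A * frob B.
Proof.
rewrite -(@ler_pXn2r _ 2) ?nnegrE ?mulr_ge0 ?frob_ge0// exprMn.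
rewrite -(frob_trmxC B) !frob_sqr mulr_suml; apply: ler_sum => i _.
rewrite mulr_sumr; apply: ler_sum => j _.
have dotE q (M : 'M[R[i]]_(q, n)) k :
    dotmx (row k M) (row k M) = (\sum_l normc (M k l) ^+ 2)%:C%C.
  rewrite dotmxE !mxE rmorph_sum; apply: eq_bigr => l _.
  by rewrite !mxE -sqr_normcE.
have [+ _] := CauchySchwarz (@dotmx _ _) (row i A) (row j (B^t*)).
rewrite /= !dotE; have -> : dotmx (row i A) (row j (B^t*)) = (A *m B) i j.
  by rewrite dotmxE !mxE; apply: eq_bigr => k _; rewrite !mxE conjCK.
by rewrite -rmorphM -[`|_|]/((normc _)%:C%C) -rmorphXn lecR.
Qed.

Lemma ler_entry_frob m n (A : 'M[R[i]]_(m, n)) i j : normc (A i j) <= frob A.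
Proof.
rewrite -(@ler_pXn2r _ 2) ?nnegrE ?frob_ge0 ?sqrtr_ge0//; last first.
  by case: (A i j) => a b; exact: sqrtr_ge0.
rewrite frob_sqr (bigD1 i)//= (bigD1 j)//= -addrA lerDl addr_ge0//.
  by apply: sumr_ge0 => k _; exact: sqr_ge0.
by apply: sumr_ge0 => k _; apply: sumr_ge0 => l _; exact: sqr_ge0.
Qed.

Lemma frob_le_entries n (A : 'M[R[i]]_n) (e : R) : 0 <= e ->
  (forall i j, `|complex.Re (A i j)| <= e /\ `|complex.Im (A i j)| <= e) ->
  frob A <= 2 * n%:R * e.
Proof.
move=> e0 Ae; rewrite -(@ler_pXn2r _ 2) ?nnegrE ?frob_ge0 ?mulr_ge0//.
rewrite frob_sqr.
apply: (@le_trans _ _ (\sum_(i < n) \sum_(j < n) (2 * e ^+ 2))).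
  apply: ler_sum => i _; apply: ler_sum => j _.
  have [] := Ae i j; case: (A i j) => a b /= ae be.
  rewrite sqr_sqrtr ?addr_ge0 ?sqr_ge0// -[a ^+ 2]real_normK ?num_real//.
  rewrite -[b ^+ 2]real_normK ?num_real//.
  have : `|a| ^+ 2 <= e ^+ 2 by rewrite ler_pXn2r ?nnegrE.
  have : `|b| ^+ 2 <= e ^+ 2 by rewrite ler_pXn2r ?nnegrE.
  lra.
rewrite !sumr_const !card_ord.
rewrite -[leLHS]mulr_natr -[X in X * _ <= _]mulr_natr.
have : 0 <= (n%:R * e) ^+ 2 by exact: sqr_ge0.
nra.
Qed.

Lemma normc_continuous : continuous normc.
Proof.
move=> z U /nbhs_ballP[e /= e0 eU]; apply/nbhs_ballP; exists e%:C%C.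
  by rewrite /= ltcR.
move=> w; rewrite /ball/= (ltcR (normc (z - w)) e) => zw; apply: eU.
rewrite /ball/=; apply: le_lt_trans zw.
rewrite ler_norml; apply/andP; split.
  rewrite lerNl opprB lerBlDr -(normcN (z - w)) opprB.
  by apply: le_trans (@le_normcD _ (w - z) z); rewrite subrK.
rewrite lerBlDr.
by apply: le_trans (@le_normcD _ (z - w) w); rewrite subrK.
Qed.

Lemma frob_continuous n : continuous (fun A : 'M[R[i]]_n => frob A).
Proof.
move=> A.
apply: (@continuous_comp _ _ _
   (fun A : 'M[R[i]]_n => \sum_i \sum_j normc (A i j) ^+ 2) Num.sqrt).
  move: A; apply: continuous_big => [|i _]; first exact: add_continuous.
  apply: continuous_big => [|j _]; first exact: add_continuous.
  move=> A; apply: (@continuous_comp _ _ _ (fun A : 'M[R[i]]_n => A i j)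
    (fun z => normc z ^+ 2)); first exact: coord_continuous.
  apply: (@continuous_comp _ _ _ normc (fun x => x ^+ 2)).
    exact: normc_continuous.
  exact: exprn_continuous.
exact: sqrt_continuous.
Qed.
End Frobenius.

(** * Chains in a group with an invariant length *)

Section TopologicalGroup.
Variable G : topologicalGroupType.
Implicit Types (x y : G) (U : set G).

Lemma continuous_mulg_inv (T : topologicalType) (f g : T -> G) :
  continuous f -> continuous g -> continuous (fun t => (f t)^-1 * g t)%g.
Proof.
move=> cf cg t; apply: (@continuous_comp _ _ _ (fun t => ((f t)^-1%g, g t))
  (fun p : G * G => (p.1 * p.2)%g)); last exact: mulg_continuous.
apply: cvg_pair => /=; last exact: cg.
exact: (@continuous_comp _ _ _ f (fun x : G => x^-1%g) t (cf t)
  (@invg_continuous G _)).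
Qed.

Lemma nbhs1_mulg U : nbhs (1%g : G) U ->
  exists2 W : set G, nbhs (1%g : G) W & forall x y, W x -> W y -> U (x * y)%g.
Proof.
move=> U1; have : nbhs (1 * 1 : G)%g U by rewrite mulg1.
move=> /(@mulg_continuous G (1, 1)%g)[[A B] /= [A1 B1] ABU].
exists (A `&` B); first exact: filterI.
by move=> x y [Ax _] [_ By]; exact: (ABU (x, y)).
Qed.

Lemma nbhs1_mulVg U : nbhs (1%g : G) U ->
  exists2 W : set G, nbhs (1%g : G) W & forall x y, W x -> W y -> U (x^-1 * y)%g.
Proof.
move=> /nbhs1_mulg[W W1 WU]; exists (W `&` [set x | W x^-1%g]).
  apply: filterI => //; apply: (@invg_continuous G 1%g).
  by rewrite invg1.
by move=> x y [_ Wx] [Wy _]; exact: WU.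
Qed.

Lemma nbhs_mulVg_l U p : nbhs (1%g : G) U ->
  nbhs p [set x | U (x^-1 * p)%g].
Proof.
move=> U1; have c := @continuous_mulg_inv G id (cst p) (fun=> cvg_id)
  (@cst_continuous _ _ p).
by apply: (c p); rewrite /= mulVg.
Qed.

End TopologicalGroup.

Section InvariantLength.
Variables (R : realType) (L : topologicalGroupType).

(** The length is only assumed continuous: the topology that it defines may be
    strictly coarser than that of [L], as for a dense one-parameter subgroup of
    a torus.  Its small balls are conjugation invariant, but they need not be
    small in [L]. *)
Record invariant_length (len : L -> R) : Prop := InvariantLength {
  len1 : len 1%g = 0 ;
  lenM : forall x y, len (x * y)%g <= len x + len y ;
  lenV : forall x, len x^-1%g = len x ;
  lenJ : forall g x, len (g * x * g^-1)%g = len x ;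
  len_separated : forall x, len x = 0 -> x = 1%g ;
  len_continuous : continuous len }.

(** The bound on every term of the chain is what keeps the set small: without
    it one would obtain the whole subgroup generated by [U]. *)
Inductive linked (len : L -> R) (e : R) (U : set L) : L -> Prop :=
| linked_one : linked len e U 1%g
| linked_step x u : linked len e U x -> U u -> len (x * u)%g <= e ->
    linked len e U (x * u)%g.

(** Taking arbitrarily small steps isolates the sheet of the [e]-ball through
    the identity.  The definition refers only to the length and the topology,
    hence is conjugation invariant; and unlike the connected component, it is
    stable under limits for a formal reason (see [linked_component_limit]). *)
Definition linked_component (len : L -> R) (e : R) : set L :=
  [set x | forall U, nbhs (1%g : L) U -> linked len e U x].

Variables (len : L -> R) (ilen : invariant_length len).
Implicit Types (x y : L) (U : set L) (e : R).

Lemma len_ge0 x : 0 <= len x.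
Proof.
have := lenM ilen x x^-1%g; rewrite mulgV (len1 ilen) (lenV ilen); lra.
Qed.

Lemma nbhs1_len e : 0 < e -> nbhs (1%g : L) [set x | len x < e].
Proof.
move=> e0; apply: (len_continuous ilen (x := 1%g) (t := [set r | r < e])).
by rewrite (len1 ilen); exact: lt_nbhsl.
Qed.

Lemma lenX x m : len (x ^+ m)%g <= m%:R * len x.
Proof.
elim: m => [|m IHm]; first by rewrite expg0 (len1 ilen) mul0r.
rewrite expgSr; apply: le_trans (lenM ilen _ _) _.
by rewrite -natr1 mulrDl mul1r lerD2r.
Qed.

Lemma linked_len e U x : 0 <= e -> linked len e U x -> len x <= e.
Proof. by move=> e0; elim=> //; rewrite (len1 ilen). Qed.

Lemma linkedS e e' U U' x : e <= e' -> U `<=` U' ->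
  linked len e U x -> linked len e' U' x.
Proof.
move=> ee' UU'; elim=> [|y u _ ylink Uu yu]; first exact: linked_one.
by apply: linked_step => //; [exact: UU'|exact: le_trans ee'].
Qed.

Lemma linkedJ e U g x : linked len e (fun u => U (g * u * g^-1)%g) x ->
  linked len e U (g * x * g^-1)%g.
Proof.
elim=> [|y u _ ylink Uu yu]; first by rewrite mulg1 mulgV; exact: linked_one.
have -> : (g * (y * u) * g^-1 = g * y * g^-1 * (g * u * g^-1))%g.
  by rewrite !mulgA mulgVK.
apply: linked_step => //.
have -> : (g * y * g^-1 * (g * u * g^-1) = g * (y * u) * g^-1)%g.
  by rewrite !mulgA mulgVK.
by rewrite (lenJ ilen).
Qed.

(** The chain of [y], translated by [x], stays within [len x + d]; the chain of
    [x] itself is only known to stay within [e]. *)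
Lemma linkedM e d U x y : linked len e U x -> linked len d U y ->
  len x + d <= e -> linked len e U (x * y)%g.
Proof.
move=> xlink ylink xde; elim: ylink => [|z u _ zlink Uu zu]; first by rewrite mulg1.
rewrite mulgA; apply: linked_step => //; rewrite -mulgA.
by apply: le_trans (lenM ilen _ _) _; apply: le_trans xde; rewrite lerD2l.
Qed.

Lemma linkedX e U x m : U x -> m%:R * len x <= e -> linked len e U (x ^+ m)%g.
Proof.
move=> Ux; elim: m => [|m IHm] xe; first by rewrite expg0; exact: linked_one.
rewrite expgSr; apply: linked_step => //.
  apply: IHm; apply: le_trans xe; rewrite ler_wpM2r ?len_ge0// ler_nat//.
by rewrite -expgSr; apply: le_trans (lenX _ _) xe.
Qed.

(** If chains end close enough to [x], one more small step reaches [x]. *)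
Lemma linked_component_limit e x : 0 <= e ->
  (forall U, nbhs (1%g : L) U ->
    exists2 z, linked len e U z & U (z^-1 * x)%g) ->
  linked_component len e x.
Proof.
move=> e0 xlim.
have xe : len x <= e.
  apply/ler_addgt0Pr => t t0; have [z zlink /= zx] := xlim _ (nbhs1_len t0).
  rewrite -[x](mulVKg z); apply: le_trans (lenM ilen _ _) _.
  by apply: lerD; [exact: linked_len zlink|exact: ltW].
move=> U /xlim[z zlink Uzx]; rewrite -[x](mulVKg z).
by apply: linked_step => //; rewrite mulVKg.
Qed.

Lemma linked_component_closed e : 0 <= e -> closed (linked_component len e).
Proof.
move=> e0 x xcl; apply: linked_component_limit => // U U1.
have [z [zV /= Uzx]] := xcl _ (nbhs_mulVg_l x U1).
by exists z => //; exact: zV.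
Qed.

Lemma linked_componentJ e g x :
  linked_component len e x -> linked_component len e (g * x * g^-1)%g.
Proof.
move=> xV U U1; apply: linkedJ; apply: xV.
have c : continuous (fun u : L => (g * u * g^-1)%g).
  move=> u; apply: (@continuous_comp _ _ _ (fun u : L => (g * u)%g)
    (fun u => u * g^-1)%g).
    apply: (@continuous_comp _ _ _ (fun u : L => (g, u))
      (fun p : L * L => p.1 * p.2)%g); last exact: mulg_continuous.
    by apply: cvg_pair => /=; [exact: cvg_cst|exact: cvg_id].
  apply: (@continuous_comp _ _ _ (fun u : L => (u, g^-1%g))
    (fun p : L * L => p.1 * p.2)%g); last exact: mulg_continuous.
  by apply: cvg_pair => /=; [exact: cvg_id|exact: cvg_cst].
by apply: (c 1%g); rewrite /= mulg1 mulgV.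
Qed.

Variable C : set L.
Hypotheses (C1 : nbhs (1%g : L) C) (cC : compact C).

(** On a compact set the length does control the topology: away from the
    identity it is bounded below by a positive minimum. *)
Lemma small_len_nbhs1 U : nbhs (1%g : L) U ->
  exists2 e, 0 < e & forall x, C x -> len x < e -> U x.
Proof.
move=> U1; have [K0|K0] := pselect (C `&` ~` U^° = set0).
  exists 1 => // x Cx _; apply: interior_subset.
  by apply: contrapT => Ux; have : (C `&` ~` U^°) x by []; rewrite K0.
have cK : compact (C `&` ~` U^°).
  by apply: compact_closedI => //; apply: open_closedC; exact: open_interior.
have K0' : C `&` ~` U^° !=set0 by exact/set0P/eqP.
have [c + cmin] := compact_EVT_min K0' cK
  (continuous_subspaceT (len_continuous ilen)).
rewrite inE => -[Cc Uc]; exists (len c).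
  rewrite lt0r len_ge0 andbT; apply/eqP => /(len_separated ilen) c1.
  by apply: Uc; rewrite c1.
move=> x Cx xc; apply: interior_subset; apply: contrapT => Ux.
by have := cmin x (mem_set (conj Cx Ux)); rewrite leNgt xc.
Qed.

(** A chain with small steps cannot leave [C]: as long as it is in [C] and has
    small length, it is so close to the identity that its next term is
    again in [C]. *)
Lemma linked_confined : exists e0 U0, [/\ 0 < e0, nbhs (1%g : L) U0 &
  forall e x, 0 <= e < e0 -> linked len e U0 x -> C x].
Proof.
have [W W1 WC] := nbhs1_mulg C1.
have [e0 e0_gt0 small] := small_len_nbhs1 W1.
exists e0, W; split=> // e x /andP[e_ge0 ee0].
elim=> [|y u ylink Cy Wu _]; first exact: nbhs_singleton.
apply: WC => //; apply: small => //.
by apply: le_lt_trans ee0; exact: linked_len ylink.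
Qed.

(** The endpoints [z], for smaller and smaller [U], all lie in the compact set
    [C]; any cluster point of theirs belongs to the linked component. *)
Lemma linked_component_approx e y r : 0 <= e ->
  (exists2 U0, nbhs (1%g : L) U0 & forall x, linked len e U0 x -> C x) ->
  (forall U, nbhs (1%g : L) U ->
    exists2 z, linked len e U z & len (z^-1 * y)%g <= r) ->
  exists2 p, linked_component len e p & len (p^-1 * y)%g <= r.
Proof.
move=> e_ge0 [U0 U01 U0C] approx.
pose P U := [set z | linked len e U z /\ len (z^-1 * y)%g <= r].
pose F := filter_from [set U | nbhs (1%g : L) U] P.
have FF : ProperFilter F.
  apply: filter_from_proper.
    apply: filter_from_filter; first by exists setT; exact: filterT.
    move=> U V U1 V1; exists (U `&` V); first exact: filterI.
    by move=> z [zlink zr]; split; split=> //; apply: linkedS zlink => // ? [].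
  by move=> U /approx[z zlink zr]; exists z.
have FC : F C by exists U0 => // z [/U0C].
have [p [_ pF]] := cC FF FC.
have near_p U : nbhs (1%g : L) U -> exists z, P U z /\ U (z^-1 * p)%g.
  move=> U1; have FPU : F (P U) by exists U.
  by have [z []] := pF _ _ FPU (nbhs_mulVg_l p U1); exists z.
exists p.
  by apply: linked_component_limit => // U /near_p[z [[zlink _] Uzp]]; exists z.
apply/ler_addgt0Pr => t t0; have [z [[_ zr] /= zp]] := near_p _ (nbhs1_len t0).
have -> : (p^-1 * y = (z^-1 * p)^-1 * (z^-1 * y))%g.
  by rewrite invgM invgK mulgA mulgK.
apply: le_trans (lenM ilen _ _) _; rewrite (lenV ilen) addrC lerD//.
exact: ltW.
Qed.

(** The nontrivial elements to which the identity is a nearest point of [V]: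
    they play the part of vectors orthogonal to the tangent space of [V]. *)
Definition far_from (V : set L) : set L :=
  [set y | 0 < len y /\ forall w, V w -> len y <= len (w^-1 * y)%g].

(** An element [x] outside the linked component is corrected by the point [v] of
    the component that is nearest to it: [v^-1 * x] is still nontrivial, still
    tends to the identity with [x], and no further correction by a small element
    of the component can shorten it. *)
Lemma far_from_near_one e : 0 < e ->
  (exists2 U0, nbhs (1%g : L) U0 & forall x, linked len e U0 x -> C x) ->
  ~ nbhs (1%g : L) (linked_component len e) ->
  forall U, nbhs (1%g : L) U ->
    U `&` far_from (linked_component len (e / 2)) !=set0.
Proof.
move=> e0 [U0 U01 U0C] notnbhs U U1.
have [W W1 WU] := nbhs1_mulVg U1.
have [d d0 small] := small_len_nbhs1 W1.
(* The corrector v has length below 2 * t: the bound by d keeps it close to the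
   identity, the bound by e / 2 leaves room to multiply it by elements of the
   linked component of radius e / 2. *)
pose t := Num.min (e / 4) (d / 2).
have t0 : 0 < t by rewrite lt_min !divr_gt0.
have [x [Wx xt xV]] : exists x, [/\ W x, len x < t & ~ linked_component len e x].
  apply: contrapT => nx; apply: notnbhs.
  apply: filterS (filterI W1 (nbhs1_len t0)) => x [Wx xt].
  by apply: contrapT => xV; apply: nx; exists x.
have VC v : linked_component len e v -> C v by move=> vV; apply: U0C; exact: vV.
have V1 : linked_component len e 1%g by move=> ? _; exact: linked_one.
have cV : compact (linked_component len e).
  apply: (@subclosed_compact _ _ C) => //.
  exact/linked_component_closed/ltW.
have [|v + vmin] := @compact_EVT_min L R (fun v => len (v^-1 * x)%g) _
    (ex_intro _ _ V1) cV.
  apply: continuous_subspaceT => v.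
  apply: (@continuous_comp _ _ _ (fun v => v^-1 * x)%g len).
    exact: (@continuous_mulg_inv L L id (cst x) (fun=> cvg_id)
      (@cst_continuous _ _ _)).
  exact: len_continuous.
rewrite inE => vV.
have yx : len (v^-1 * x)%g <= len x.
  by have := vmin 1%g (mem_set V1); rewrite invg1 mul1g.
have v2t : len v < 2 * t.
  have := lenM ilen x (v^-1 * x)^-1%g.
  by rewrite (lenV ilen) invgM invgK mulVKg; lra.
exists (v^-1 * x)%g; split.
  apply: WU => //; apply: small; first exact: VC.
  apply: lt_le_trans v2t _; rewrite mulrC -ler_pdivlMr//.
  by rewrite ge_min lexx orbT.
split.
  rewrite lt0r len_ge0 andbT; apply/eqP => /(len_separated ilen) y1.
  by apply: xV; rewrite -[x](mulVKg v) y1 mulg1.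
move=> w wV; rewrite mulgA -invgM; apply: vmin; rewrite inE => O O1.
apply: linkedM (wV _ O1) _; first exact: vV.
have : t <= e / 4 by rewrite ge_min lexx.
lra.
Qed.

(** The linked components are invariant, and confinement to the compact set [C]
    makes them small; only their being neighbourhoods is in question. *)
Lemma SIN_of_linked_component :
  (forall e, 0 < e ->
    (exists2 U0, nbhs (1%g : L) U0 & forall x, linked len e U0 x -> C x) ->
    nbhs (1%g : L) (linked_component len e)) -> SIN L.
Proof.
move=> nbhsV U U1.
have [e0 [U0 [e0_gt0 U01 U0C]]] := linked_confined.
have [d d0 small] := small_len_nbhs1 U1.
pose e := Num.min e0 d / 2.
have m0 : 0 < Num.min e0 d by rewrite lt_min e0_gt0.
have e_gt0 : 0 < e by rewrite divr_gt0.
have em : e < Num.min e0 d by rewrite /e; lra.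
have /andP[ee0 ed] : (e < e0) && (e < d) by rewrite -lt_min.
have conf x : linked len e U0 x -> C x by apply: U0C; rewrite ltW.
exists (linked_component len e); split.
- by apply: nbhsV => //; exists U0.
- move=> x xV; have xlink := xV _ U01; apply: small; first exact: conf.
  by apply: le_lt_trans ed; apply: linked_len xlink; exact: ltW.
- by move=> g x; exact: linked_componentJ.
Qed.

End InvariantLength.

(** * Groups with a faithful unitary representation *)

(** A bounded real function converges along an ultrafilter. *)
Lemma ultra_bounded_near (R : realType) (T : Type) (F : set_system T)
    (f : T -> R) (b : R) : UltraFilter F -> F [set x | `|f x| <= b] ->
  exists a, forall e, 0 < e -> F [set x | `|a - f x| <= e].
Proof.
move=> FU Fb; have FP : ProperFilter F by exact: ultra_proper.
have fFb : (f @ F) [set` `[- b, b]].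
  rewrite /fmap/=; apply: filterS Fb => x xb /=.
  by rewrite in_itv/= -ler_norml.
have [a [_ acl]] := segment_compact (fmap_proper_filter f FP) fFb.
exists a => e e0; have [//|Fn] := in_ultra_setVsetC [set x | `|a - f x| <= e] FU.
have [r [/= nr ar]] :=
  acl (~` [set r | `|a - r| <= e]) _ Fn (nbhsx_ballx a e e0).
by case: nr; exact: ltW.
Qed.

Section FaithfulRepresentation.
Variables (R : realType) (L : topologicalGroupType) (n : nat).
Variable rho : L -> 'M[R[i]]_n.
Hypothesis rho_rep : unitary_representation rho.
Hypothesis rho_inj : injective rho.

Definition rep_len (x : L) : R := frob (rho x - 1%:M).

Let rhoU x : rho x \is unitarymx. Proof. by case: rho_rep. Qed.
Let rhoM x y : rho (x * y)%g = rho x *m rho y. Proof. by case: rho_rep. Qed.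

Lemma rep1 : rho 1%g = 1%:M.
Proof.
have u := unitarymx_unit (rhoU 1%g).
by rewrite -[LHS]mulmx1 -(mulmxV u) mulmxA -rhoM mulg1 mulmxV.
Qed.

Lemma frob_repB x y : frob (rho x - rho y) = rep_len (x^-1 * y)%g.
Proof.
rewrite frob_distC -[RHS](frob_Umulmx _ (rhoU x)) mulmxBr -rhoM mulVKg.
by rewrite mulmx1.
Qed.

Lemma rep_len_continuous : continuous rep_len.
Proof.
move=> x; apply: (@continuous_comp _ _ _ (fun x => rho x - 1%:M) (@frob R n n)).
  have [_ _ rc] := rho_rep.
  by apply: continuousB; [exact: rc|exact: cst_continuous].
exact: frob_continuous.
Qed.

Lemma rep_len_invariant : invariant_length rep_len.
Proof.
have lenV x : rep_len x^-1%g = rep_len x.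
  by rewrite -[x^-1%g]mulg1 -frob_repB rep1.
split=> //.
- by rewrite /rep_len rep1 subrr frob0.
- move=> x y; rewrite -{1}[x]invgK -frob_repB.
  apply: le_trans (_ : frob ((rho x^-1%g - 1%:M) + (1%:M - rho y)) <= _).
    by rewrite addrA subrK.
  apply: le_trans (ler_frobD _ _) _.
  by rewrite [X in _ + X]frob_distC -!/(rep_len _) lenV.
- move=> g x; rewrite /rep_len !rhoM.
  rewrite -(frob_mulmxU _ (rhoU g)) mulmxBl -!mulmxA -(rhoM g^-1%g).
  rewrite mulVg rep1.
  by rewrite mulmx1 mul1mx -{2}[rho g]mulmx1 -mulmxBr frob_Umulmx.
- move=> x /frob_eq0 /eqP; rewrite subr_eq0 -rep1 => /eqP; exact: rho_inj.
- exact: rep_len_continuous.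
Qed.

Let ilen := rep_len_invariant.

(** The first-order expansion of a power.  The error is the sum of the products
    [(rho (x ^+ k) - 1) *m (rho x - 1)] for [k < m], and invariance bounds the
    length of [x ^+ k] by [k * rep_len x]. *)
Lemma frob_repX x m :
  frob (rho (x ^+ m)%g - 1%:M - m%:R%:C%C *: (rho x - 1%:M))
  <= (m%:R * rep_len x) ^+ 2.
Proof.
elim: m => [|m IHm].
  by rewrite expg0 rep1 subrr scale0r subr0 frob0 sqr_ge0.
set Z := rho x - 1%:M in IHm *.
have -> : rho (x ^+ m.+1)%g - 1%:M - m.+1%:R%:C%C *: Z =
    (rho (x ^+ m)%g - 1%:M - m%:R%:C%C *: Z) + (rho (x ^+ m)%g - 1%:M) *m Z.
  rewrite -natr1 rmorphD scalerDl scale1r expgSr rhoM.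
  rewrite mulmxBl mul1mx /Z mulmxBr mulmx1.
  set P := rho _ *m rho x; set Q := rho (x ^+ m)%g; set S := _ *: _.
  apply/matrixP => i j; rewrite !mxE; ring.
apply: le_trans (ler_frobD _ _) _; apply: le_trans (lerD IHm (frobM _ _)) _.
rewrite -/(rep_len x) -/(rep_len _).
have /ler_wpM2r := lenX ilen x m; move=> /(_ _ (len_ge0 ilen x)).
have : 0 <= rep_len x ^+ 2 by exact: sqr_ge0.
have : 0 <= m%:R * rep_len x ^+ 2 by rewrite mulr_ge0// sqr_ge0.
rewrite -natr1 expr2 => ? ? ?; nra.
Qed.

(** Near the identity this is an approximate unit tangent vector at [y]. *)
Definition rep_direction (y : L) : 'M[R[i]]_n :=
  ((rep_len y)^-1)%:C%C *: (rho y - 1%:M).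

(** Directions lie in a bounded subset of a finite-dimensional space, so they
    converge along some ultrafilter finer than the neighbourhoods of the
    identity in [P]. *)
Lemma near_direction (P : set L) e : 0 < e ->
  (forall y, P y -> 0 < rep_len y) ->
  (forall U, nbhs (1%g : L) U -> U `&` P !=set0) ->
  exists P', [/\ P' `<=` P,
    forall U, nbhs (1%g : L) U -> U `&` P' !=set0 &
    forall y z, P' y -> P' z ->
      frob (rep_direction y - rep_direction z) <= e].
Proof.
move=> e0 Ppos Pacc; pose F := within P (nbhs (1%g : L)).
have FF : ProperFilter F.
  split; last exact: within_filter.
  by move=> /Pacc[y [yn Py]]; exact: yn.
have [G [GU FG]] := ultraFilterLemma FF.
have GP : ProperFilter G by exact: ultra_proper.
have GPP : G P by apply: FG; exact: withinT.
have entryle y i j : P y -> `|complex.Re (rep_direction y i j)| <= 1 /\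
    `|complex.Im (rep_direction y i j)| <= 1.
  move=> Py; have le1 : frob (rep_direction y) <= 1.
    rewrite frobZ -/(rep_len y) normfV gtr0_norm ?Ppos// mulVf// gt_eqF//.
    exact: Ppos.
  have := le_trans (ler_entry_frob _ i j) le1.
  case: (rep_direction y i j) => a b /= ab1; split; apply: le_trans ab1.
    by rewrite -sqrtr_sqr ler_sqrt ?addr_ge0 ?sqr_ge0// lerDl sqr_ge0.
  by rewrite -sqrtr_sqr ler_sqrt ?addr_ge0 ?sqr_ge0// lerDr sqr_ge0.
(* Two entries are 2 * d apart, and frob_le_entries multiplies this by 2 * n. *)
pose d := e / (4 * n.+1%:R).
have d0 : 0 < d by rewrite divr_gt0// mulr_gt0.
have near_entry i j : exists ab : R * R, G [set y |
    `|ab.1 - complex.Re (rep_direction y i j)| <= d /\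
    `|ab.2 - complex.Im (rep_direction y i j)| <= d].
  have [|a aP] := @ultra_bounded_near R L G
      (fun y => complex.Re (rep_direction y i j)) 1 GU.
    by apply: filterS GPP => y Py; have [] := entryle y i j Py.
  have [|b bP] := @ultra_bounded_near R L G
      (fun y => complex.Im (rep_direction y i j)) 1 GU.
    by apply: filterS GPP => y Py; have [] := entryle y i j Py.
  by exists (a, b); apply: filterI; [exact: aP|exact: bP].
pose h i j := projT1 (cid (near_entry i j)).
pose Q i j := [set y | `|(h i j).1 - complex.Re (rep_direction y i j)| <= d /\
    `|(h i j).2 - complex.Im (rep_direction y i j)| <= d].
have GQ : G [set y | forall i j, Q i j y].
  apply: filter_forall => i; apply: filter_forall => j.
  exact: (projT2 (cid (near_entry i j))).
exists (P `&` [set y | forall i j, Q i j y]); split.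
- by move=> y [].
- move=> U U1; apply: (@filter_ex _ G); apply: filterI; last exact: filterI.
  by apply: FG; apply: filterS U1 => y Uy _.
move=> y z [_ Qy] [_ Qz].
have d2 : 0 <= 2 * d by rewrite mulr_ge0// ltW.
apply: le_trans (frob_le_entries d2 _) _.
  move=> i j; rewrite mxE [X in _ + X]mxE; have [] := Qz i j; have [] := Qy i j.
  move: (rep_direction y i j) (rep_direction z i j) => [a b] [a' b'] /=.
  move=> ya yb za zb; rewrite mulr_natl mulr2n.
  split; first by rewrite (le_trans (ler_distD (h i j).1 _ _))// lerD// distrC.
  by rewrite (le_trans (ler_distD (h i j).2 _ _))// lerD// distrC.
rewrite /d; have n1 : 0 < n.+1%:R :> R by [].
rewrite !mulrA ler_pdivrMr ?mulr_gt0//.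
rewrite -natr1; have : 0 <= n%:R :> R by []; nra.
Qed.

(** If [z] is much shorter than [y] but points in nearly the same direction, a
    power of [z] whose length is about that of [y] comes close to [y].  Of
    [s = rep_len y], at most a quarter is lost to each of the quadratic error
    [s ^+ 2], the rounding of the exponent, and the angle. *)
Lemma rep_powers_approach y z (s := rep_len y) :
  0 < rep_len z <= s / 4 -> 0 < s <= 1 / 4 ->
  frob (rep_direction z - rep_direction y) <= 1 / 4 ->
  exists m, m%:R * rep_len z <= s /\
    rep_len ((z ^+ m)^-1 * y)%g <= 3 / 4 * s.
Proof.
move=> /andP[z0 zs] /andP[s0 s1] zy.
pose m := Num.trunc (s / rep_len z).
have /andP[ms sm] : m%:R <= s / rep_len z < m.+1%:R.
  by apply: truncn_itv; rewrite divr_ge0// ltW.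
have mzs : m%:R * rep_len z <= s by rewrite -ler_pdivlMr.
have szm : s < m%:R * rep_len z + rep_len z.
  by rewrite -{2}[rep_len z]mul1r -mulrDl natr1 -ltr_pdivrMr.
exists m; split=> //; rewrite -frob_repB.
(* Nonlinear error, rounding error and angular error, in this order. *)
have -> : rho (z ^+ m)%g - rho y =
  (rho (z ^+ m)%g - 1%:M - m%:R%:C%C *: (rho z - 1%:M)) +
  ((m%:R * rep_len z - s)%:C%C *: rep_direction z +
   s%:C%C *: (rep_direction z - rep_direction y)).
  have sY : s%:C%C *: rep_direction y = rho y - 1%:M.
    by rewrite scalerA -rmorphM divff ?gt_eqF// scale1r.
  have mZ : (m%:R * rep_len z)%:C%C *: rep_direction z =
      m%:R%:C%C *: (rho z - 1%:M).
    by rewrite scalerA -rmorphM mulfK ?gt_eqF.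
  rewrite rmorphB scalerBl mZ [X in _ + (_ + X)]scalerBr sY.
  set A := _ *: (_ - _); set B := _ *: rep_direction z.
  by apply/matrixP => i j; rewrite !mxE; ring.
apply: le_trans (ler_frobD _ _) _.
apply: le_trans (lerD (frob_repX _ _) (ler_frobD _ _)) _.
rewrite !frobZ.
have -> : frob (rho z - 1%:M) = rep_len z by [].
rewrite normfV (gtr0_norm z0) mulVf ?gt_eqF// mulr1 (gtr0_norm s0).
have -> : `|m%:R * rep_len z - s| = s - m%:R * rep_len z.
  by rewrite distrC ger0_norm// subr_ge0.
have m0 : 0 <= m%:R * rep_len z by rewrite mulr_ge0// ltW.
nra.
Qed.

(** If the linked component were not a neighbourhood of the identity, elements
    orthogonal to it with nearly equal directions would accumulate there.  The
    powers of the shorter ones form chains with arbitrarily small steps, so a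
    limit of such powers is in the linked component, yet closer to a longer one
    than the identity is. *)
Lemma SIN_of_faithful_rep (C : set L) : nbhs (1%g : L) C -> compact C -> SIN L.
Proof.
move=> C1 cC; apply: (SIN_of_linked_component ilen C1 cC) => e e0 conf.
apply: contrapT => notnbhs.
have acc := far_from_near_one ilen cC e0 conf notnbhs.
have [||P' [P'far P'acc P'dir]] := @near_direction _ (1 / 4) _ _ acc.
- by rewrite divr_gt0.
- by move=> y [].
have t0 : 0 < Num.min (1 / 4) (e / 2) by rewrite lt_min !divr_gt0.
have [y [/= ys P'y]] := P'acc _ (nbhs1_len ilen t0).
have /andP[ys1 yse] : (rep_len y < 1 / 4) && (rep_len y < e / 2) by rewrite -lt_min.
have [y0 yfar] := P'far _ P'y.
have [U0 U01 U0C] := conf.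
have [|||p pV py] := @linked_component_approx _ _ _ ilen _ cC (e / 2) y
  (3 / 4 * rep_len y).
- by rewrite divr_ge0 ?ltW.
- by exists U0 => // x xlink; apply: U0C; apply: linkedS xlink => //; lra.
- move=> U U1.
  have y40 : 0 < rep_len y / 4 by rewrite divr_gt0.
  have [z [[Uz /= zy] P'z]] := P'acc _ (filterI U1 (nbhs1_len ilen y40)).
  have [z0 _] := P'far _ P'z.
  have [||m [mz mzy]] := rep_powers_approach _ _ (P'dir _ _ P'z P'y).
  - by rewrite z0 ltW.
  - by rewrite y0 ltW.
  exists (z ^+ m)%g => //; apply: linkedX => //; lra.
have := yfar _ pV; lra.
Qed.

End FaithfulRepresentation.

(** * The quotient by the kernel of a representation *)

Section Kernel.
Variables (R : realType) (G : topologicalGroupType) (n : nat).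
Variable rho : G -> 'M[R[i]]_n.
Hypothesis rho_rep : unitary_representation rho.

Let rhoU x : rho x \is unitarymx. Proof. by case: rho_rep. Qed.
Let rhoM x y : rho (x * y)%g = rho x *m rho y. Proof. by case: rho_rep. Qed.
Let rho1 := rep1 rho_rep.

Definition rep_kernel_set : set G := [set x | rho x = 1%:M].

Fact rep_kernel1 : rep_kernel_set 1%g. Proof. exact: rho1. Qed.

Fact rep_kernelM x y :
  rep_kernel_set x -> rep_kernel_set y -> rep_kernel_set (x * y)%g.
Proof. by rewrite /rep_kernel_set/= rhoM => -> ->; rewrite mulmx1. Qed.

Fact rep_kernelV x : rep_kernel_set x -> rep_kernel_set x^-1%g.
Proof.
by rewrite /rep_kernel_set/= => x1; rewrite -[LHS]mulmx1 -{1}x1 -rhoM mulVg rho1.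
Qed.

Fact rep_kernelJ g x : rep_kernel_set x -> rep_kernel_set (g * x * g^-1)%g.
Proof.
by rewrite /rep_kernel_set/= => x1; rewrite !rhoM x1 mulmx1 -rhoM mulgV rho1.
Qed.

Definition rep_kernel : normalSubgroup G :=
  NormalSubgroup rep_kernel1 rep_kernelM rep_kernelV rep_kernelJ.

Lemma rep_kernel_closed : closed rep_kernel.
Proof.
rewrite (_ : nsg_set _ = rep_len rho @^-1` [set 0]).
  apply: closed_comp; last exact: closed_eq.
  by move=> x _; exact: rep_len_continuous.
apply/seteqP; split=> x /=; rewrite /rep_kernel_set/= /rep_len.
  by move=> ->; rewrite subrr frob0.
by move=> /frob_eq0/eqP; rewrite subr_eq0 => /eqP.
Qed.

Lemma rep_eq_kernel x y : rho x = rho y <-> nsg_set rep_kernel (x^-1 * y)%g.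
Proof.
rewrite /= /rep_kernel_set/= rhoM.
split=> [<-|xy]; first by rewrite -rhoM mulVg rho1.
by rewrite -[LHS]mulmx1 -xy mulmxA -rhoM mulgV rho1 mul1mx.
Qed.

Definition quotient_rep (q : quotient_group rep_kernel) : 'M[R[i]]_n :=
  rho (repr q).

Lemma quotient_rep_pi x :
  quotient_rep (\pi_(quotient_group rep_kernel)%qT x) = rho x.
Proof. exact/rep_eq_kernel/repr_pi. Qed.

Lemma quotient_rep_inj : injective quotient_rep.
Proof.
move=> a b /rep_eq_kernel /pi_quotient_groupP.
by rewrite !reprK.
Qed.

Lemma quotient_rep_unitary : unitary_representation quotient_rep.
Proof.
split=> [q|a b|]; first exact: rhoU.
  by rewrite -rhoM; exact: quotient_rep_pi.
apply/(@quotient_continuous _ {eq_quot (coset_equiv rep_kernel)}%qT).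
rewrite (_ : _ \o _ = rho); first by case: rho_rep.
by apply/funext => x; exact: quotient_rep_pi.
Qed.

(** The quotient carries the faithful representation induced by [rho], and the
    image of [C] under the open projection is a compact neighbourhood. *)
Lemma SIN_quotient_rep_kernel (C : set G) : nbhs (1%g : G) C -> compact C ->
  SIN (quotient_group rep_kernel).
Proof.
move=> C1 cC; pose p : G -> quotient_group rep_kernel :=
  \pi_(quotient_group rep_kernel)%qT.
apply: (SIN_of_faithful_rep quotient_rep_unitary quotient_rep_inj
  (C := p @` C)).
  exact: pi_nbhs.
apply: continuous_compact => //; apply: continuous_subspaceT.
exact: pi_continuous.
Qed.

End Kernel.

Theorem theorem2p1 (R : realType) (G : topologicalGroupType) :
  locally_compact_group G -> MAP R G -> RSIN G.
Proof.
move=> [_ lcG] mapG; apply/seteqP; split=> [x xN|_ -> N _]; last exact: nsg1.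
apply: contrapT => x1; have [n [rho [rho_rep rhox]]] := mapG x 1%g x1.
have [C C1 [cC _]] := lcG 1%g I.
apply: rhox; rewrite (rep1 rho_rep).
apply: (xN (rep_kernel rho_rep)); split; first exact: rep_kernel_closed.
apply: SIN_quotient_rep_kernel cC.
by move: C1; rewrite withinET.
Qed.
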